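(* Let $\Omega\subseteq\mathbb{R}^n$ be closed and convex, let $H:\mathbb{R}^n\to\mathbb{R}^n$ be continuous on $\mathbb{R}^n$ and pseudomonotone on $\Omega$, and assume $\mathrm{SOL}(\Omega,H)\neq\emptyset$. Suppose in addition that $H$ is locally Lipschitz continuous at any solution of $\mathrm{VI}(\Omega,H)$. Let $\{x_k\}_{k\ge 0}$ be the sequence generated by the EG-Anderson(1) algorithm with initial stepsize parameter $\gamma>0$, and assume that the algorithm does not stop after finitely many iterations. Then there exists a positive integer $N_0$ such that $$\min_{N_0+1\le k\le N}\|F_\gamma(x_k)\|^2=O\left(\frac1N\right)\qquad (N\to\infty).$$
   Context: Notation. $\|\cdot\|$ is the Euclidean norm on $\mathbb{R}^n$ and $P_\Omega$ is the Euclidean projection onto $\Omega$. The variational inequality problem $\mathrm{VI}(\Omega,H)$ is to find $x^*\in\Omega$ with $\langle H(x^* ),x-x^*\rangle\ge 0$ for all $x\in\Omega$; its solution set is $\mathrm{SOL}(\Omega,H)$. $H$ is pseudomonotone on $\Omega$ if for all $x,y\in\Omega$, $\langle H(x),y-x\rangle\ge 0$ implies $\langle H(y),y-x\rangle\ge 0$. $H$ is locally Lipschitz continuous at a point $x^*$ if there are $r>0$ and $L^*>0$ with $\|H(x)-H(y)\|\le L^*\|x-y\|$ for all $x,y\in\mathbb{R}^n$ with $\|x-x^*\|\le r$, $\|y-x^*\|\le r$. For $t>0$ and $x\in\mathbb{R}^n$ put $G_t(x)=P_\Omega(x-tH(x))$, $\tilde G_t(x)=P_\Omega(x-tH(G_t(x)))$,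 $F_t(x)=G_t(x)-x$, $\tilde F_t(x)=\tilde G_t(x)-x$. EG-Anderson(1) algorithm. Parameters: $\omega\ge 0$, $\gamma>0$, $\tau>\frac12$, $\rho,\mu\in(0,1)$, and a (sufficiently large) constant $M>0$. Choose $x_0\in\Omega$ and set $\sigma_0=1$. For $k=0,1,2,\ldots$ do: Step 1. If $F_\gamma(x_k)=\mathbf 0$, stop. Otherwise set $t_k=\gamma$ and go to Step 2. Step 2 (line search). Compute $y_{k+0.5}=P_\Omega(x_k-t_kH(x_k))$ and $y_{k+1}=P_\Omega(x_k-t_kH(y_{k+0.5}))$. If $$t_k\langle H(y_{k+0.5})-H(x_k),\,y_{k+0.5}-y_{k+1}\rangle\le\frac{\mu}{2}\left(\|x_k-y_{k+0.5}\|^2+\|y_{k+0.5}-y_{k+1}\|^2\right),$$ go to Step 3. Otherwise replace $t_k$ by $\rho t_k$ and repeat Step 2. (Thus, for the final $t_k$, $y_{k+0.5}=G_{t_k}(x_k)$ and $y_{k+1}=\tilde G_{t_k}(x_k)$.) Step 3. Compute $F_{t_k}(x_k)=y_{k+0.5}-x_k$ and $\tilde F_{t_k}(x_k)=y_{k+1}-x_k$. If $\|\tilde F_{t_k}(x_k)\|<\min\{\|F_{t_k}(x_k)\|,\ \omega\sigma_k^{-\tau}\}$, set $$\alpha_k=\frac{\langle\tilde F_{t_k}(x_k),\,\tilde F_{t_k}(x_k)-F_{t_k}(x_k)\rangle}{\|\tilde F_{t_k}(x_k)-F_{t_k}(x_k)\|^2};$$ otherwise set $\alpha_k=M+1$.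 Step 4. If $|\alpha_k|\le M$, set $x_{k+1}=\alpha_kx_k+(1-\alpha_k)y_{k+1}$ and $\sigma_{k+1}=\sigma_k+1$. Otherwise set $x_{k+1}=y_{k+1}$ and $\sigma_{k+1}=\sigma_k$. *)

(* Defs.v *)
From mathcomp Require Import all_boot all_order all_algebra.
From mathcomp Require Import all_classical all_reals all_analysis.

Set Implicit Arguments.
Unset Strict Implicit.
Unset Printing Implicit Defensive.

Import Order.TTheory GRing.Theory Num.Theory.
Import numFieldNormedType.Exports.

Local Open Scope classical_set_scope.
Local Open Scope ring_scope.

(* The library norm `|x| on 'rV[R]_n is the sup norm, hence the definitions
   below; the library topology on 'rV[R]_n is the usual one of R^n. *)

Definition dotv (R : realType) (n : nat) (u v : 'rV[R]_n) : R :=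
  \sum_(i < n) u 0 i * v 0 i.

Definition enorm (R : realType) (n : nat) (u : 'rV[R]_n) : R :=
  Num.sqrt (dotv u u).

Section VariationalInequality.
Context {R : realType} {n : nat}.
Implicit Types (Om : set 'rV[R]_n) (H : 'rV[R]_n -> 'rV[R]_n) (x y : 'rV[R]_n).

(* The closest point of Om to x; it exists and is unique when Om is closed,
   convex and nonempty (otherwise the value may be the dummy 0). *)
Definition proj Om x : 'rV[R]_n :=
  xget 0 [set p | Om p /\ forall y, Om y -> enorm (x - p) <= enorm (x - y)].

Definition SOL Om H : set 'rV[R]_n :=
  [set z | Om z /\ forall x, Om x -> 0 <= dotv (H z) (x - z)].

Definition pseudomonotone Om H : Prop :=
  forall x y, Om x -> Om y ->
    0 <= dotv (H x) (y - x) -> 0 <= dotv (H y) (y - x).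

Definition locally_lipschitz_at H x : Prop :=
  exists r L : R, [/\ 0 < r, 0 < L &
    forall y z, enorm (y - x) <= r -> enorm (z - x) <= r ->
      enorm (H y - H z) <= L * enorm (y - z)].

Definition G Om H (t : R) x : 'rV[R]_n := proj Om (x - t *: H x).

Definition Gtilde Om H (t : R) x : 'rV[R]_n := proj Om (x - t *: H (G Om H t x)).

Definition F Om H (t : R) x : 'rV[R]_n := G Om H t x - x.

Definition Ftilde Om H (t : R) x : 'rV[R]_n := Gtilde Om H t x - x.

End VariationalInequality.

Section EGAnderson.
Context {R : realType} {n : nat}.
Variables (Om : set 'rV[R]_n) (H : 'rV[R]_n -> 'rV[R]_n).
Variables (omega gamma tau rho mu M : R).

(* The test of the line search at x with trial stepsize t: here G t x is the
   half-step y_{k+0.5} and Gtilde t x is the full step y_{k+1}. *)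
Definition line_search_test (t : R) (x : 'rV[R]_n) : Prop :=
  let y := G Om H t x in
  let z := Gtilde Om H t x in
  t * dotv (H y - H x) (y - z) <=
    mu / 2 * (enorm (x - y) ^+ 2 + enorm (y - z) ^+ 2).

(* t is the first stepsize among gamma, rho * gamma, rho^2 * gamma, ...
   that passes the test. *)
Definition line_search (x : 'rV[R]_n) (t : R) : Prop :=
  exists m : nat, [/\ t = rho ^+ m * gamma, line_search_test t x &
    forall j, (j < m)%N -> ~ line_search_test (rho ^+ j * gamma) x].

Definition anderson_coef (t : R) (sigma : nat) (x : 'rV[R]_n) : R :=
  let f := F Om H t x in
  let g := Ftilde Om H t x in
  if enorm g < Num.min (enorm f) (omega * sigma%:R `^ (- tau))
  then dotv g (g - f) / enorm (g - f) ^+ 2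
  else M + 1.

(* The next pair (x_{k+1}, sigma_{k+1}). *)
Definition eg_anderson_update (t : R) (x : 'rV[R]_n) (sigma : nat) :
    'rV[R]_n * nat :=
  let z := Gtilde Om H t x in
  let alpha := anderson_coef t sigma x in
  if `|alpha| <= M then (alpha *: x + (1 - alpha) *: z, sigma.+1)
  else (z, sigma).

(* x is a sequence of iterates of EG-Anderson(1). An iteration is performed
   only while F_gamma(x_k) <> 0; once the algorithm has stopped, the later
   values of x are not constrained. *)
Definition eg_anderson_iterates (x : nat -> 'rV[R]_n) : Prop :=
  exists (t : nat -> R) (sigma : nat -> nat),
    [/\ Om (x 0%N), sigma 0%N = 1%N &
      forall k, (forall j, (j <= k)%N -> F Om H gamma (x j) <> 0) ->
        line_search (x k) (t k) /\
        (x k.+1, sigma k.+1) = eg_anderson_update (t k) (x k) (sigma k)].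

End EGAnderson.

(* Minimum of u k over a <= k <= b, meant for a <= b: the default value u a
   of the iterated minimum is then one of the terms. *)
Definition min_range (R : realType) (u : nat -> R) (a b : nat) : R :=
  \big[Num.min/u a]_(a <= k < b.+1) u k.

(* Main.v *)
Require Import Defs.
From mathcomp Require Import all_boot all_order all_algebra.
From mathcomp Require Import all_classical all_reals all_analysis.
From mathcomp Require Import ring lra zify.

Set Implicit Arguments.
Unset Strict Implicit.
Unset Printing Implicit Defensive.

Import Order.TTheory GRing.Theory Num.Theory.
Import numFieldNormedType.Exports.

Local Open Scope classical_set_scope.
Local Open Scope ring_scope.

(* For a solution p, an extragradient step decreases |x_k - p|^2 by at least
   (1 - mu) |F_{t_k}(x_k)|^2.  The Anderson coefficient is always below 1/2, so
   an accelerated step keeps at least half of this decrease, up to an error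
   M (1 + M) |Ftilde|^2 <= M (1 + M) omega^2 sigma_k^(- 2 tau), and these errors
   are summable because sigma_k counts the accelerated steps and 2 tau > 1.
   Hence (x_k) is bounded and the |F_{t_k}(x_k)|^2 are summable.

   The step sizes are eventually bounded below.  Near a point u at which the
   test fails for arbitrarily small t with arbitrarily small F_t, the failed
   tests force u to be a solution, and local Lipschitz continuity of H at u then
   makes the test pass; compactness of a ball makes this uniform.  Convergence
   of (x_k) is not needed.  Since |F_gamma| <= (gamma / t) |F_t| for t <= gamma,
   the |F_gamma(x_k)|^2 are summable from some rank on, and their minimum over
   k <= N is at most their average. *)

(** * Euclidean inner product, norm and compact balls *)

Section Euclidean.
Context {R : realType} {n : nat}.
Implicit Types (u v w : 'rV[R]_n) (a : R).

Lemma dotvC u v : dotv u v = dotv v u.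
Proof. by apply: eq_bigr => i _; rewrite mulrC. Qed.

Lemma dotvDl u v w : dotv (u + v) w = dotv u w + dotv v w.
Proof. by rewrite -big_split; apply: eq_bigr => i _; rewrite mxE mulrDl. Qed.

Lemma dotvZl a u v : dotv (a *: u) v = a * dotv u v.
Proof. by rewrite mulr_sumr; apply: eq_bigr => i _; rewrite mxE mulrA. Qed.

Lemma dotvNl u v : dotv (- u) v = - dotv u v.
Proof. by rewrite -scaleN1r dotvZl mulN1r. Qed.

Lemma dotvDr u v w : dotv w (u + v) = dotv w u + dotv w v.
Proof. by rewrite dotvC dotvDl !(dotvC w). Qed.

Lemma dotvZr a u v : dotv u (a *: v) = a * dotv u v.
Proof. by rewrite dotvC dotvZl (dotvC u). Qed.

Lemma dotvNr u v : dotv u (- v) = - dotv u v.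
Proof. by rewrite dotvC dotvNl (dotvC u). Qed.

Lemma dotv0l u : dotv 0 u = 0.
Proof. by rewrite -(scale0r 0) dotvZl mul0r. Qed.

Definition dotvE := (dotvDl, dotvDr, dotvNl, dotvNr, dotvZl, dotvZr).

Lemma dotv_ge0 u : 0 <= dotv u u.
Proof. by apply: sumr_ge0 => i _; rewrite -expr2 sqr_ge0. Qed.

Lemma enorm_ge0 u : 0 <= enorm u.
Proof. exact: sqrtr_ge0. Qed.

Lemma enorm_sqr u : enorm u ^+ 2 = dotv u u.
Proof. by rewrite sqr_sqrtr// dotv_ge0. Qed.

Lemma coord_le_enorm u i : `|u 0 i| <= enorm u.
Proof.
rewrite -sqrtr_sqr; apply: ler_wsqrtr; rewrite /dotv (bigD1 i)//= -expr2 lerDl.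
by apply: sumr_ge0 => j _; rewrite -expr2 sqr_ge0.
Qed.

Lemma enorm_eq0 u : enorm u = 0 -> u = 0.
Proof.
move=> u0; apply/rowP => i; apply/eqP; rewrite mxE -normr_le0 -u0.
exact: coord_le_enorm.
Qed.

Lemma enorm_gt0 u : (0 < enorm u) = (u != 0).
Proof.
rewrite lt_neqAle enorm_ge0 andbT eq_sym; congr (~~ _); apply/eqP/eqP.
  exact: enorm_eq0.
by move=> ->; rewrite /enorm dotv0l sqrtr0.
Qed.

Lemma normr_le_enorm u : `|u| <= enorm u.
Proof.
rewrite [leLHS]/Num.norm/= mx_normrE; apply/bigmax_leP; split => [|[i j] _ /=].
  exact: enorm_ge0.
by rewrite ord1 coord_le_enorm.
Qed.

Lemma dotv_le_enorm u v : dotv u v <= enorm u * enorm v.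
Proof.
have [->|u0] := eqVneq u 0; first by rewrite dotv0l mulr_ge0 ?enorm_ge0.
have [->|v0] := eqVneq v 0; first by rewrite dotvC dotv0l mulr_ge0 ?enorm_ge0.
have uv0 : 0 < enorm u * enorm v by rewrite mulr_gt0 ?enorm_gt0.
(* Expanded, this is twice [enorm u * enorm v] times the Cauchy-Schwarz defect. *)
have := dotv_ge0 (enorm v *: u - enorm u *: v).
rewrite !dotvE (dotvC v u) -!enorm_sqr => h.
rewrite -(ler_pM2l uv0); nra.
Qed.

Lemma enormN u : enorm (- u) = enorm u.
Proof. by rewrite /enorm !dotvE opprK. Qed.

Lemma enormB u v : enorm (u - v) = enorm (v - u).
Proof. by rewrite -enormN opprB. Qed.

Lemma enormD u v : enorm (u + v) <= enorm u + enorm v.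
Proof.
rewrite -(@ler_pXn2r _ 2)// ?nnegrE ?addr_ge0 ?enorm_ge0//.
have := dotv_le_enorm u v.
by rewrite sqrrD !enorm_sqr !dotvE (dotvC v u); lra.
Qed.

Lemma enorm_distD w u v : enorm (u - v) <= enorm (u - w) + enorm (w - v).
Proof. by rewrite -[u - v](subrKA w) enormD. Qed.

Lemma cvg_dotv {T : Type} {Fl : set_system T} {FF : Filter Fl}
    (f g : T -> 'rV[R]_n) u v :
  f @ Fl --> u -> g @ Fl --> v ->
  (fun x => dotv (f x) (g x)) @ Fl --> dotv u v.
Proof.
move=> fu gv; apply: cvg_big => [|i _]; first exact: add_continuous.
apply: cvgM.
- exact: (continuous_cvg _ (@coord_continuous R 1 n 0 i u) fu).
- exact: (continuous_cvg _ (@coord_continuous R 1 n 0 i v) gv).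
Qed.

Lemma cvg_enorm {T : Type} {Fl : set_system T} {FF : Filter Fl}
    (f : T -> 'rV[R]_n) u :
  f @ Fl --> u -> (fun x => enorm (f x)) @ Fl --> enorm u.
Proof.
move=> fu.
exact: (continuous_cvg _ (@sqrt_continuous R (dotv u u)) (cvg_dotv fu fu)).
Qed.

Lemma compact_enorm_ball w (r : R) : compact [set u | enorm (u - w) <= r].
Proof.
apply: bounded_closed_compact.
  exists (`|w| + r); split; first by rewrite num_real.
  move=> c rc u /= ur; apply: le_trans (ltW rc).
  rewrite -[u](subrK w) addrC; apply: le_trans (ler_normD _ _) _.
  by rewrite lerD2l; exact: le_trans (normr_le_enorm _) ur.
apply: (@preimage_closed _ _ (fun u => enorm (u - w)) [set a | a <= r]) => //.
  move=> u _; apply: (@cvg_enorm _ (nbhs u)).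
  by apply: cvgB; [apply: cvg_refl|apply: cvg_cst].
Qed.

End Euclidean.

(** * Existence and variational characterisation of the projection *)

Section Projection.
Context {R : realType} {n : nat}.
Variable Om : set 'rV[R]_n.
Hypotheses (Om_closed : closed Om) (Om_convex : convex_set Om).
Hypothesis Om_neq0 : Om !=set0.
Implicit Types x y : 'rV[R]_n.

Lemma convex_set_segment x y (s : R) : 0 <= s <= 1 -> Om x -> Om y ->
  Om (x + s *: (y - x)).
Proof.
move=> s01 Omx Omy; have [s0 s1] := andP s01.
have := Om_convex (Itv01 s0 s1) (mem_set Omy) (mem_set Omx).
rewrite inE; congr Om.
change (s *: y + (1 - s) *: x = x + s *: (y - x)).
by rewrite scalerBr scalerBl scale1r addrCA.
Qed.

(** Points farther from [x] than a fixed [w] in [Om] cannot be closest, so it suffices to minimise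
    over a compact piece of [Om]; hence [xget] never falls back on its default. *)
Lemma proj_min x : Om (Defs.proj Om x) /\
  forall y, Om y -> enorm (x - Defs.proj Om x) <= enorm (x - y).
Proof.
have [w Omw] := Om_neq0.
pose K := [set u | enorm (u - x) <= enorm (w - x)] `&` Om.
have cK : compact K.
  by apply: compact_closedI => //; exact: compact_enorm_ball.
have K0 : K !=set0 by exists w; split => /=.
have cf : {within K, continuous (fun u => enorm (u - x))}.
  apply: continuous_subspaceT => u; apply: (@cvg_enorm _ _ _ (nbhs u)).
  by apply: cvgB; [apply: cvg_refl|apply: cvg_cst].
have [c /set_mem [cw Omc] cmin] := EVT_min_rV K0 cK cf.
apply: (@xgetPex _ 0 [set p | Om p /\ forall y, Om y -> enorm (x - p) <= enorm (x - y)]).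
exists c; split => // y Omy; rewrite enormB (enormB x).
have [yw|/ltW yw] := leP (enorm (y - x)) (enorm (w - x)).
  exact/cmin/mem_set.
exact: le_trans cw yw.
Qed.

Lemma proj_in x : Om (Defs.proj Om x).
Proof. by have [] := proj_min x. Qed.

Lemma proj_vi x y : Om y -> dotv (x - Defs.proj Om x) (y - Defs.proj Om x) <= 0.
Proof.
move=> Omy; have [Omp pmin] := proj_min x; move: Omp pmin.
move: (Defs.proj Om x) => p Omp pmin; rewrite leNgt; apply/negP.
set d := dotv _ _ => d0; set q := dotv (y - p) (y - p).
have q0 : 0 <= q by exact: dotv_ge0.
have dq : 0 < d + q by rewrite ltr_pwDl.
(* Moving from [p] towards [y] by a fraction [s] changes the squared distance by [s^2 q - 2 s d].
   This choice of [s] lies in ]0, 1] even if [q = 0], and [s q <= d] makes the change negative. *)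
have s0 : 0 < d / (d + q) by rewrite divr_gt0.
have := pmin _ (convex_set_segment _ Omp Omy) => /(_ (d / (d + q))).
rewrite (ltW s0) ler_pdivrMr// mul1r lerDl q0 => /(_ isT).
rewrite -(@ler_pXn2r _ 2)// ?nnegrE ?enorm_ge0// !enorm_sqr opprD addrA.
set s := d / (d + q) in s0 *.
have sq : s * (d + q) = d by rewrite mulfVK// gt_eqF.
rewrite !(dotvDl (x - p)) !(dotvDr (x - p)) !(dotvNl, dotvNr, dotvZl, dotvZr).
rewrite (dotvC (y - p) (x - p)) -/d -/q; nra.
Qed.

End Projection.

(** * Residuals and the energy inequality of one iteration *)

Section Extragradient.
Context {R : realType} {n : nat}.
Variables (Om : set 'rV[R]_n) (H : 'rV[R]_n -> 'rV[R]_n).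
Hypotheses (Om_closed : closed Om) (Om_convex : convex_set Om).
Implicit Types x y z : 'rV[R]_n.

(** Weighting the projection inequalities at stepsizes [s] and [t] by [t] and [s] cancels [H x];
    Cauchy-Schwarz then gives [key], whose sign pattern yields both bounds. *)
Lemma enorm_F_mono x (s t : R) : Om !=set0 -> 0 < s -> s <= t ->
  enorm (F Om H s x) <= enorm (F Om H t x) /\
  s * enorm (F Om H t x) <= t * enorm (F Om H s x).
Proof.
move=> Om_neq0 s0 st; have t0 := lt_le_trans s0 st.
have Gin r : Om (G Om H r x) by exact: proj_in.
have vis := proj_vi Om_closed Om_convex Om_neq0 (x - s *: H x) (Gin t).
have vit := proj_vi Om_closed Om_convex Om_neq0 (x - t *: H x) (Gin s).
rewrite -!/(G _ _ _ _) in vis vit.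
have GE r : G Om H r x = x + F Om H r x by rewrite /F addrC subrK.
rewrite !GE in vis vit; move: vis vit.
move: (F Om H s x) (F Om H t x) (H x) => a b h vis vit.
have a0 := enorm_ge0 a; have b0 := enorm_ge0 b.
have key : (t * enorm a - s * enorm b) * (enorm a - enorm b) <= 0.
  have ab := dotv_le_enorm a b.
  have : t * dotv a a + s * dotv b b <= (t + s) * dotv a b.
    move: vis vit.
    rewrite !dotvE ?(dotvC a x) ?(dotvC b x) ?(dotvC h x) ?(dotvC b a).
    nra.
  by rewrite -!enorm_sqr; nra.
have [ab|ab|ab] := ltgtP (enorm a) (enorm b).
- split; first by [].
  move: key; rewrite nmulr_lle0 ?subr_lt0//; lra.
- move: key; rewrite pmulr_lle0 ?subr_gt0// => key.
  suff : t * enorm b < t * enorm a by nra.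
  by rewrite ltr_pM2l.
- by split=> //; rewrite -ab ler_wpM2r.
Qed.

(** The inequality at [z] bounds the left side by [|x - p|^2 - |x - z|^2 + 2 t <H y, p - z>].
    Splitting [p - z] at [y], pseudomonotonicity discards one part; the inequality at [y] and the
    line-search test control the other. *)
Lemma extragradient_descent (t mu : R) x y z p :
  0 <= t ->
  dotv (x - t *: H x - y) (z - y) <= 0 ->
  dotv (x - t *: H y - z) (p - z) <= 0 ->
  0 <= dotv (H y) (y - p) ->
  t * dotv (H y - H x) (y - z) <=
    mu / 2 * (enorm (x - y) ^+ 2 + enorm (y - z) ^+ 2) ->
  enorm (z - p) ^+ 2 <=
    enorm (x - p) ^+ 2 - (1 - mu) * (enorm (x - y) ^+ 2 + enorm (y - z) ^+ 2).
Proof.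
move=> t0 vy vz pm; have {}pm := mulr_ge0 t0 pm; rewrite !enorm_sqr.
move: vy vz pm; rewrite !dotvE.
rewrite ?(dotvC y x) ?(dotvC z x) ?(dotvC p x) ?(dotvC z y) ?(dotvC p y).
by rewrite ?(dotvC p z); lra.
Qed.

(* The coefficient minimises the norm of [a f + (1 - a) g]; since [g] is the
   shorter vector, the minimiser puts more weight on [g]. *)
Lemma anderson_coef_lt_half (f g : 'rV[R]_n) : enorm g < enorm f ->
  dotv g (g - f) / enorm (g - f) ^+ 2 < 1 / 2.
Proof.
move=> gf; have gf2 : dotv g g < dotv f f.
  by rewrite -!enorm_sqr ltr_pXn2r// nnegrE enorm_ge0.
have d0 : 0 < enorm (g - f) ^+ 2.
  rewrite exprn_gt0// enorm_gt0 subr_eq0; apply/eqP => e.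
  by rewrite e ltxx in gf.
rewrite ltr_pdivrMr// enorm_sqr !dotvE (dotvC f g); lra.
Qed.

(** For negative [a] the last term is nonnegative: it is the error that an accelerated step can
    introduce. *)
Lemma enorm_affine_comb (a : R) x z p :
  enorm (a *: x + (1 - a) *: z - p) ^+ 2 =
  a * enorm (x - p) ^+ 2 + (1 - a) * enorm (z - p) ^+ 2
  - a * (1 - a) * enorm (z - x) ^+ 2.
Proof.
rewrite !enorm_sqr !dotvE (dotvC z x) (dotvC p x) (dotvC p z); ring.
Qed.

Hypothesis H_pseudomonotone : pseudomonotone Om H.
Variables (omega tau mu M : R).
Hypotheses (omega_ge0 : 0 <= omega) (mu_lt1 : mu < 1).
Hypothesis M_gt0 : 0 < M.

(* Every accelerated step increments [s], so the errors of these steps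
   telescope into the sum below. *)
Definition anderson_error (s : nat) : R :=
  M * (1 + M) * \sum_(1 <= i < s) (omega * i%:R `^ (- tau)) ^+ 2.

Lemma eg_anderson_step (t : R) x s x' s' p :
  0 < t -> line_search_test Om H mu t x -> SOL Om H p -> (0 < s)%N ->
  (x', s') = eg_anderson_update Om H omega tau M t x s ->
  (0 < s')%N /\
  enorm (x' - p) ^+ 2 + (1 - mu) / 2 * enorm (F Om H t x) ^+ 2 <=
    enorm (x - p) ^+ 2 + (anderson_error s' - anderson_error s).
Proof.
move=> t0 test [Omp solp] s0 upd; have Om_neq0 : Om !=set0 by exists p.
have [z zE] : exists z, Gtilde Om H t x = z by eexists.
have [y yE] : exists y, G Om H t x = y by eexists.
have vy : dotv (x - t *: H x - y) (z - y) <= 0.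
  by rewrite -yE; apply: proj_vi => //; rewrite -zE; exact: proj_in.
have vz : dotv (x - t *: H y - z) (p - z) <= 0.
  by rewrite -zE -yE; exact: proj_vi.
have Omy : Om y by rewrite -yE; exact: proj_in.
move: test; rewrite /line_search_test /F zE yE => test.
have := extragradient_descent (ltW t0) vy vz
  (H_pseudomonotone Omp Omy (solp _ Omy)) test.
move: upd; rewrite /eg_anderson_update /anderson_coef /F /Ftilde zE yE.
move=> upd; rewrite (enormB x y) => desc.
have f0 : 0 <= enorm (y - x) ^+ 2 by rewrite exprn_ge0 ?enorm_ge0.
have yz0 : 0 <= enorm (y - z) ^+ 2 by rewrite exprn_ge0 ?enorm_ge0.
have mu1 : 0 < 1 - mu by rewrite subr_gt0.
have mf0 := mulr_ge0 (ltW mu1) f0; have myz0 := mulr_ge0 (ltW mu1) yz0.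
have {}desc : enorm (z - p) ^+ 2 <=
    enorm (x - p) ^+ 2 - (1 - mu) * enorm (y - x) ^+ 2 by lra.
move: upd; set alpha := (if _ then _ else M + 1).
have [aM [-> ->]|_ [-> ->]] := leP `|alpha| M; last first.
  by split=> //; rewrite subrr addr0; lra.
split=> //; rewrite enorm_affine_comb.
rewrite /anderson_error big_nat_recr//= [M * _ * (_ + _)]mulrDr.
rewrite [X in _ <= _ + X]addrAC subrr add0r.
(* The fallback value [M + 1] is excluded by [aM], so the acceptance test of the acceleration
   held. *)
have [alt gs] : alpha < 1 / 2 /\ enorm (z - x) <= omega * s%:R `^ (- tau).
  move: aM; rewrite /alpha; case: ifPn => [|_].
    by rewrite lt_min => /andP[gf gs] _; split; [exact: anderson_coef_lt_half|exact: ltW].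
  by rewrite ger0_norm ?addr_ge0 ?(ltW M_gt0)//; lra.
have gs2 : enorm (z - x) ^+ 2 <= (omega * s%:R `^ (- tau)) ^+ 2.
  by rewrite ler_pXn2r// nnegrE ?enorm_ge0// mulr_ge0 ?powR_ge0.
have g0 : 0 <= enorm (z - x) ^+ 2 by rewrite exprn_ge0 ?enorm_ge0.
move: aM; rewrite ler_norml => /andP[aM1 aM2].
have h1 : - (alpha * (1 - alpha)) * enorm (z - x) ^+ 2 <=
    M * (1 + M) * (omega * s%:R `^ (- tau)) ^+ 2.
  apply: (@le_trans _ _ (M * (1 + M) * enorm (z - x) ^+ 2)).
    by rewrite ler_wpM2r//; nra.
  by rewrite ler_wpM2l//; nra.
have h2 : (1 - alpha) * enorm (z - p) ^+ 2 <= (1 - alpha) *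
    (enorm (x - p) ^+ 2 - (1 - mu) * enorm (y - x) ^+ 2).
  by rewrite ler_wpM2l//; lra.
(* Since [1 - alpha > 1/2], at least half of the decrease survives. *)
have h3 : 0 <= (1 / 2 - alpha) * ((1 - mu) * enorm (y - x) ^+ 2).
  by apply: mulr_ge0; [lra|apply: mulr_ge0 => //; lra].
lra.
Qed.

End Extragradient.

(** * Summability of the acceleration errors *)

(** Cauchy condensation: the terms decrease, so the block from [2^m] to [2^(m+1)] contributes at
    most [2^m f(2^m) = q^m], a geometric term. *)
Lemma sum_powR_bounded {R : realType} (tau : R) : 1 / 2 < tau ->
  exists C : R, forall s,
    \sum_(1 <= i < s) (i%:R `^ (- tau)) ^+ 2 <= C.
Proof.
move=> tau2; pose f (i : nat) : R := (i%:R `^ (- tau)) ^+ 2.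
have f0 i : 0 <= f i by exact: sqr_ge0.
(* This is [2^(1 - 2 tau)], below 1 exactly because [tau > 1/2]. *)
pose q : R := 2 * f 2%N.
have q0 : 0 <= q by rewrite mulr_ge0.
have q1 : q < 1.
  rewrite /q /f -powR_mulrn ?powR_ge0// -powRrM -[X in X * _]powRr1//.
  rewrite -powRD ?pnatr_eq0 ?implybT//.
  have := @gt0_ltr_powR R (tau * 2 - 1) _ 1 2; rewrite !nnegrE powR1.
  rewrite subr_gt0 -ltr_pdivrMr// => /(_ tau2 ler01 (ler0n _ 2)).
  rewrite ltr1n => /(_ isT) h.
  have -> : 1 + - tau * 2 = - (tau * 2 - 1) by ring.
  by rewrite powRN invf_lt1 ?powR_gt0.
have fX m : (2 ^ m)%:R * f (2 ^ m)%N = q ^+ m.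
  rewrite /q exprMn natrX; congr (_ * _).
  rewrite /f natrX -[2 ^+ m]powR_mulrn// powRAC powR_mulrn ?powR_ge0//.
  by rewrite -!exprM mulnC.
have f_le i j : (0 < i)%N -> (i <= j)%N -> f j <= f i.
  move=> i0 ij; rewrite ler_pXn2r// ?nnegrE ?powR_ge0//.
  rewrite !powRN lef_pV2 ?posrE ?powR_gt0 ?ltr0n//; last exact: leq_trans ij.
  by apply: ge0_ler_powR; rewrite ?nnegrE ?ler0n ?ler_nat//; lra.
have block m : (1 - q) * \sum_(1 <= i < 2 ^ m) f i <= 1 - q ^+ m.
  elim: m => [|m IH]; first by rewrite big_geq// mulr0 expr0 subrr.
  have p2 : (0 < 2 ^ m)%N by rewrite expn_gt0.
  rewrite (@big_cat_nat _ _ _ (2 ^ m)) ?leq_exp2l//=.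
  have : \sum_(2 ^ m <= i < 2 ^ m.+1) f i <= q ^+ m.
    rewrite -fX mulr_natl; apply: (@le_trans _ _ (\sum_(2 ^ m <= i < 2 ^ m.+1) f (2 ^ m)%N)).
      by apply: ler_sum_nat => i /andP[mi _]; exact: f_le.
    by rewrite sumr_const_nat expnS mul2n -addnn addnK.
  move: IH; rewrite exprS; nra.
exists (1 / (1 - q)) => s.
rewrite ler_pdivlMr ?subr_gt0// mulrC.
have s2 : (s <= 2 ^ s)%N by exact/ltnW/ltn_expl.
have [s0|s0] := leqP s 1; first by rewrite big_geq// mulr0.
apply: (@le_trans _ _ ((1 - q) * \sum_(1 <= i < 2 ^ s) f i)).
  rewrite ler_wpM2l ?subr_ge0 ?(ltW q1)// [leRHS](@big_cat_nat _ _ _ s)//=; last exact: ltnW.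
  by rewrite lerDl; apply: sumr_ge0 => i _.
by apply: le_trans (block s) _; rewrite gerBl exprn_ge0.
Qed.

(** * Uniform success of the line search for small steps and residuals *)

Section Stepsize.
Context {R : realType} {n : nat}.
Variables (Om : set 'rV[R]_n) (H : 'rV[R]_n -> 'rV[R]_n).
Hypotheses (Om_closed : closed Om) (Om_convex : convex_set Om).
Hypothesis Om_neq0 : Om !=set0.
Hypothesis H_continuous : continuous H.
Variables (mu rho : R).
Hypotheses (mu_gt0 : 0 < mu) (rho_gt0 : 0 < rho) (rho_lt1 : rho < 1).
Implicit Types (x y z u : 'rV[R]_n) (s t e : R).

(** Cauchy-Schwarz on the left of the test and AM-GM on its right leave a common factor [|y - z|],
    which cancels; it is nonzero because the inequality is strict. *)
Lemma line_search_test_fail s x : 0 < s -> ~ line_search_test Om H mu s x ->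
  mu * enorm (F Om H s x) < s * enorm (H (G Om H s x) - H x).
Proof.
move=> s0 /negP; rewrite /line_search_test /F -ltNge.
move: (G Om H s x) (Gtilde Om H s x) => y z.
rewrite (enormB x y) => test.
have cs := dotv_le_enorm (H y - H x) (y - z).
have yz0 := enorm_ge0 (y - z); have yx0 := enorm_ge0 (y - x).
have amgm : mu * (enorm (y - x) * enorm (y - z)) <=
    mu / 2 * (enorm (y - x) ^+ 2 + enorm (y - z) ^+ 2).
  have := mulr_ge0 (ltW mu_gt0) (sqr_ge0 (enorm (y - x) - enorm (y - z))).
  rewrite sqrrB; lra.
have {}cs : s * dotv (H y - H x) (y - z) <=
    s * (enorm (H y - H x) * enorm (y - z)) by rewrite ler_wpM2l// ltW.
have : mu * enorm (y - x) * enorm (y - z) <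
    s * enorm (H y - H x) * enorm (y - z) by rewrite -!mulrA; lra.
move: yz0; rewrite le_eqVlt => /predU1P[<-|yz0]; first by rewrite !mulr0 ltxx.
by rewrite ltr_pM2r.
Qed.

Lemma cvg_enorm_le (f : nat -> 'rV[R]_n) (g : nat -> R) u :
  (forall j, enorm (f j - u) <= g j) -> g @ \oo --> 0 -> f @ \oo --> u.
Proof.
move=> fg g0; apply/cvgrPdist_le => e e0; near=> j.
rewrite distrC; apply: le_trans (normr_le_enorm _) _; apply: le_trans (fg j) _.
by near: j; apply: (cvgr_le 0).
Unshelve. all: by end_near. Qed.

(* A failed test bounds [|y - x| / s] by a multiple of [|H y - H x|], which
   is small when [x] and [y] are close; so a limit of failing points solves the
   variational inequality. *)
Lemma SOL_limit_of_failures u (x : nat -> 'rV[R]_n) (s : nat -> R) :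
  (forall j, 0 < s j) ->
  (forall j, ~ line_search_test Om H mu (s j) (x j)) ->
  x @ \oo --> u -> (fun j => G Om H (s j) (x j)) @ \oo --> u -> SOL Om H u.
Proof.
move=> s0 fail xu yu; split.
  by apply: (closed_cvg Om Om_closed _ u yu); apply: nearW => j; exact: proj_in.
move=> w Omw; rewrite -(pmulr_rge0 _ mu_gt0).
pose y j := G Om H (s j) (x j).
(* Nonnegative by the projection inequality and the failure bound; the second summand vanishes in
   the limit. *)
pose a j := mu * dotv (H (x j)) (w - y j) +
  enorm (H (y j) - H (x j)) * enorm (w - y j).
have a0 j : 0 <= a j.
  have vi := proj_vi Om_closed Om_convex Om_neq0 (x j - s j *: H (x j)) Omw.
  have := line_search_test_fail (s0 j) (fail j).
  rewrite -/(G _ _ _ _) in vi; move: vi; rewrite /a /y /F.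
  move: (G _ _ _ _) (s0 j) => z sj; rewrite enormB addrAC dotvDl dotvNl dotvZl.
  move=> vi h; rewrite -(pmulr_rge0 _ sj) mulrDr.
  have := dotv_le_enorm (- (x j - z)) (w - z); rewrite enormN dotvNl => cs.
  have := ler_wpM2r (enorm_ge0 (w - z)) (ltW h).
  have := ler_wpM2l (ltW mu_gt0) cs; have := ler_wpM2l (ltW mu_gt0) vi; lra.
have Hx := cvg_comp _ _ xu (@H_continuous u).
have Hy := cvg_comp _ _ yu (@H_continuous u).
have wy : w - y j @[j --> \oo] --> w - u by apply: cvgB => //; exact: cvg_cst.
have : a j @[j --> \oo] --> mu * dotv (H u) (w - u) + enorm (H u - H u) * enorm (w - u).
  apply: cvgD; first by apply: cvgMr; exact: cvg_dotv.
  by apply: cvgM; apply: cvg_enorm => //; exact: cvgB.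
rewrite subrr [enorm 0]/enorm dotv0l sqrtr0 mul0r addr0 => al.
apply: (closed_cvg _ (@closed_ge _ 0) _ _ al).
by apply: nearW.
Qed.

Hypothesis H_lipschitz : forall z, SOL Om H z -> locally_lipschitz_at H z.

(** The stepsize [t / rho] is the trial preceding [t] in the backtracking. If the claim failed,
    rejected trials along radii [harmonic j] would make [u] a solution, where the Lipschitz bound
    contradicts rejection. *)
Lemma line_search_test_local u : exists2 e, 0 < e & forall x t,
  enorm (x - u) < e -> 0 < t -> t < e -> enorm (F Om H t x) < e ->
  line_search_test Om H mu (t / rho) x.
Proof.
apply: contrapT => noe.
have /choice[xt xtP] : forall j : nat, exists xt : 'rV[R]_n * R,
    [/\ enorm (xt.1 - u) < harmonic j, 0 < xt.2, xt.2 < harmonic j,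
        enorm (F Om H xt.2 xt.1) < harmonic j &
        ~ line_search_test Om H mu (xt.2 / rho) xt.1].
  move=> j; apply: contrapT => nox; apply: noe.
  exists (harmonic j) => [|x t xu t0 tj ft]; first exact: harmonic_gt0.
  by apply: contrapT => fail; apply: nox; exists (x, t).
pose x j := (xt j).1; pose s j := (xt j).2 / rho; pose y j := G Om H (s j) (x j).
have s0 j : 0 < s j by rewrite divr_gt0//; case: (xtP j).
have fail j : ~ line_search_test Om H mu (s j) (x j) by case: (xtP j).
(* One bound for both sequences: passing from [t] to [t / rho] enlarges the residual by at most
   [rho^-1]. *)
have xle j : enorm (x j - u) <= (rho^-1 + 1) * harmonic j.
  have [h _ _ _ _] := xtP j; apply: le_trans (ltW h) _.
  by rewrite ler_peMl ?harmonic_ge0// lerDr invr_ge0 ltW.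
have yle j : enorm (y j - u) <= (rho^-1 + 1) * harmonic j.
  have [h t0 _ ft _] := xtP j.
  have ts : (xt j).2 <= s j by rewrite /s ler_pdivlMr// ler_piMr// ltW.
  have [_] := enorm_F_mono H Om_closed Om_convex (x j) Om_neq0 t0 ts.
  rewrite /s mulrAC -mulrA ler_pM2l// => FG.
  apply: le_trans (enorm_distD (x j) _ _) _; rewrite mulrDl mul1r lerD ?(ltW h)//.
  apply: le_trans FG _; rewrite mulrC ler_wpM2l ?invr_ge0 ?(ltW rho_gt0)//.
  exact: ltW.
have c0 : (rho^-1 + 1) * harmonic j @[j --> \oo] --> (0 : R).
  by rewrite -(mulr0 (rho^-1 + 1)); apply: cvgMr; exact: cvg_harmonic.
have xu : x @ \oo --> u by exact: cvg_enorm_le c0.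
have yu : y @ \oo --> u by exact: cvg_enorm_le c0.
have [r [L [r0 L0 lip]]] := H_lipschitz (SOL_limit_of_failures s0 fail xu yu).
(* The bound [r] puts both points in the Lipschitz ball; [mu / L] forces [s N * L <= mu], against
   the failure bound. *)
have : \forall j \near \oo, (rho^-1 + 1) * harmonic j <= Num.min r (mu / L).
  by apply: (cvgr_le 0) => //; rewrite lt_min r0 divr_gt0.
move=> [N _ /(_ N (leqnn N))]; rewrite /= le_min => /andP[Nr NL].
have := line_search_test_fail (s0 N) (fail N); apply/negP; rewrite -leNgt.
have sL : s N * L <= mu.
  rewrite -ler_pdivlMr//; apply: le_trans NL.
  have [_ _ th _ _] := xtP N; rewrite mulrDl mul1r /s mulrC.
  rewrite (@le_trans _ _ (rho^-1 * harmonic N))// ?lerDl ?harmonic_ge0//.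
  by rewrite ler_wpM2l ?invr_ge0 ?ltW.
have := lip (y N) (x N) (le_trans (yle N) Nr) (le_trans (xle N) Nr).
move=> /(ler_wpM2l (ltW (s0 N))) /le_trans; apply.
by rewrite mulrA ler_wpM2r ?enorm_ge0.
Qed.

(** The local property persists when [e] shrinks, so compactness gives one [e] for the whole
    ball. *)
Lemma line_search_test_ball p (r : R) : exists2 e, 0 < e & forall x t,
  enorm (x - p) <= r -> 0 < t -> t < e -> enorm (F Om H t x) < e ->
  line_search_test Om H mu (t / rho) x.
Proof.
pose P e x := forall t, 0 < t -> t < e -> enorm (F Om H t x) < e ->
  line_search_test Om H mu (t / rho) x.
have /(_ R (0 : R)^'+ P _) := (compact_near_coveringP _).1 (@compact_enorm_ball R n p r).
case=> [u _|].
  have [e e0 eP] := line_search_test_local u.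
  exists ([set x | enorm (x - u) < e], [set d | d < e]) => /=.
    split; last by apply: nbhs_right_lt.
    have : enorm (x - u) @[x --> u] --> enorm (u - u).
      by apply: (@cvg_enorm _ _ _ (nbhs u)); apply: cvgB; [apply: cvg_refl|apply: cvg_cst].
    rewrite [enorm (u - u)]/enorm subrr dotv0l sqrtr0 => /cvgr_lt; exact.
  move=> [x d]/= [xu de] t t0 td Fd.
  by apply: eP => //; [exact: lt_trans de|exact: lt_trans de].
move=> e e0 eP.
(* The covering result holds for positive radii strictly below [e]. *)
have h2 : 0 < e / 2 by rewrite divr_gt0.
exists (e / 2) => // x t xp; apply: (eP (e / 2)) => //=.
by rewrite sub0r normrN gtr0_norm// ltr_pdivrMr// ltr_pMr// ltr1n.
Qed.

End Stepsize.

(** * From bounded sums to the rate of the running minimum *)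

Lemma bigmin_seq_le {R : realType} (u : nat -> R) (v : R) (r : seq nat) k :
  k \in r -> \big[Num.min/v]_(i <- r) u i <= u k.
Proof.
elim: r => // i r IH; rewrite inE big_cons ge_min => /predU1P[->|/IH ->].
  by rewrite lexx.
by rewrite orbT.
Qed.

Lemma min_range_ge0 {R : realType} (u : nat -> R) a b :
  (forall k, 0 <= u k) -> 0 <= min_range u a b.
Proof.
move=> u0; rewrite /min_range; elim/big_ind: _ => // v w v0 w0.
by rewrite le_min v0.
Qed.

Lemma min_range_bigO {R : realType} (u : nat -> R) (K : R) (a : nat) :
  (forall k, 0 <= u k) ->
  (forall N, \sum_(a.+1 <= k < N) u k <= K) ->
  (fun N : nat => min_range u a.+1 N : R^o) =O_\oo (fun N : nat => N%:R^-1 : R^o).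
Proof.
move=> u0 uK; have K0 : 0 <= K by apply: le_trans (uK a.+1); rewrite big_geq.
(* For [N > 2 a] the range has [N - a >= N / 2] terms, so its minimum is at most [2 K / N]; the 1
   makes the constant positive and the bound strict. *)
apply/eqO_exP; exists (2 * K + 1); first by rewrite ltr_wpDl// mulr_ge0.
exists (2 * a).+1 => // N /= aN.
have N0 : 0 < N%:R :> R by rewrite ltr0n; exact: leq_trans aN.
rewrite ger0_norm ?min_range_ge0// ger0_norm ?invr_ge0 ?ltW//.
rewrite ltr_pdivlMr//; apply: (@le_lt_trans _ _ (2 * K)); last by rewrite ltrDl.
have m0 := min_range_ge0 a.+1 N u0.
have : (N - a)%:R * min_range u a.+1 N <= K.
  apply: le_trans (uK N.+1).
  rewrite mulr_natl -subSS -sumr_const_nat; apply: ler_sum_nat => k kN.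
  by apply: bigmin_seq_le; rewrite mem_index_iota.
have : N%:R <= 2 * (N - a)%:R :> R by rewrite -natrM ler_nat mulnBr; lia.
move=> h1 h2; have := ler_wpM2r m0 h1; lra.
Qed.

Lemma bounded_series_eventually_small {R : realType} (u : nat -> R) (K e : R) :
  (forall k, 0 <= u k) -> (forall N, \sum_(0 <= k < N) u k <= K) -> 0 < e ->
  exists N, forall k, (N <= k)%N -> u k < e.
Proof.
move=> u0 uK e0; have : cvgn (series u).
  apply: nondecreasing_is_cvgn; first exact: nondecreasing_series.
  by exists K => _ [N _ <-]; exact: uK.
by move=> /cvg_series_cvg_0 /cvgr_lt /(_ _ e0) [N _ NP]; exists N.
Qed.

(** * Assembly of the convergence rate *)

Unset Implicit Arguments.

Theorem theorem3p6 (R : realType) (n : nat)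
    (Om : set 'rV[R]_n) (H : 'rV[R]_n -> 'rV[R]_n)
    (omega gamma tau rho mu M : R) (x : nat -> 'rV[R]_n)
    (Om_closed : closed Om)
    (Om_convex : convex_set Om)
    (H_continuous : continuous H)
    (H_pseudomonotone : pseudomonotone Om H)
    (SOL_nonempty : SOL Om H !=set0)
    (H_lipschitz : forall z, SOL Om H z -> locally_lipschitz_at H z)
    (omega_ge0 : 0 <= omega)
    (gamma_gt0 : 0 < gamma)
    (tau_gt_half : 1 / 2 < tau)
    (rho_gt0 : 0 < rho) (rho_lt1 : rho < 1)
    (mu_gt0 : 0 < mu) (mu_lt1 : mu < 1)
    (M_gt0 : 0 < M)
    (x_iterates : eg_anderson_iterates Om H omega gamma tau rho mu M x)
    (no_stop : forall k, F Om H gamma (x k) <> 0) :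
  exists2 N0 : nat, (0 < N0)%N &
    (fun N : nat =>
       min_range (fun k => enorm (F Om H gamma (x k)) ^+ 2) N0.+1 N : R^o)
    =O_\oo (fun N : nat => N%:R^-1 : R^o).
Proof.
have [t [sigma [_ sigma0 iter]]] := x_iterates.
have [p solp] := SOL_nonempty.
have Om_neq0 : Om !=set0 by exists p; case: solp.
have {}iter k := iter k (fun j _ => no_stop j).
have t_gt0 k : 0 < t k.
  by have [[m [-> _ _]] _] := iter k; rewrite mulr_gt0// exprn_gt0.
have t_le k : t k <= gamma.
  have [[m [-> _ _]] _] := iter k.
  by rewrite ler_piMl ?exprn_ile1 ?(ltW gamma_gt0) ?(ltW rho_gt0) ?(ltW rho_lt1).
pose f k := enorm (F Om H (t k) (x k)) ^+ 2.
have f_ge0 k : 0 <= f k by exact: sqr_ge0.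
pose err := anderson_error omega tau M.
have c_gt0 : 0 < (1 - mu) / 2 by rewrite divr_gt0// subr_gt0.
have energy k : (0 < sigma k)%N /\ enorm (x k - p) ^+ 2 +
    (1 - mu) / 2 * \sum_(0 <= j < k) f j <= enorm (x 0%N - p) ^+ 2 + err (sigma k).
  elim: k => [|k [sk IH]].
    by rewrite sigma0 big_geq// mulr0 /err /anderson_error big_geq// mulr0.
  have [[m [_ test _]] upd] := iter k.
  have [sk1] := eg_anderson_step Om_closed Om_convex H_pseudomonotone
    omega_ge0 mu_lt1 M_gt0 (t_gt0 k) test solp sk upd.
  by rewrite big_nat_recr//= -/err -/(f k); split=> //; lra.
have [C sumC] := sum_powR_bounded tau_gt_half.
pose B := enorm (x 0%N - p) ^+ 2 + M * (1 + M) * (omega ^+ 2 * C).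
have errB k : enorm (x 0%N - p) ^+ 2 + err (sigma k) <= B.
  rewrite lerD2l ler_wpM2l ?mulr_ge0 ?addr_ge0 ?(ltW M_gt0)//.
  under eq_bigr do rewrite exprMn.
  by rewrite -mulr_sumr ler_wpM2l ?sqr_ge0.
(* The energy bound gives [|x k - p|^2 <= B], and [B + 1] dominates the square root of [B]. *)
have x_bounded k : enorm (x k - p) <= B + 1.
  have [_] := energy k; have := errB k.
  have : 0 <= (1 - mu) / 2 * \sum_(0 <= j < k) f j.
    by rewrite mulr_ge0 ?(ltW c_gt0)//; apply: sumr_ge0.
  have := enorm_ge0 (x k - p); nra.
have sum_f k : \sum_(0 <= j < k) f j <= B / ((1 - mu) / 2).
  rewrite ler_pdivlMr// mulrC; have [_] := energy k; have := errB k.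
  have := sqr_ge0 (enorm (x k - p)); lra.
have [e e_gt0 test_small] := line_search_test_ball Om_closed Om_convex Om_neq0
  H_continuous mu_gt0 rho_gt0 rho_lt1 H_lipschitz p (B + 1).
have [N0 f_small] := bounded_series_eventually_small f_ge0 sum_f
  (exprn_gt0 2 e_gt0).
(* A step below [gamma] was reduced at least once, so [t k / rho] was rejected; below [e] this
   contradicts [test_small]. *)
have t_ge k : (N0 <= k)%N -> Num.min e gamma <= t k.
  move=> kN; rewrite leNgt lt_min; apply/negP => /andP[te tg].
  have Fe : enorm (F Om H (t k) (x k)) < e.
    rewrite -(@ltr_pXn2r _ 2)// ?nnegrE ?enorm_ge0 ?(ltW e_gt0)//.
    exact: f_small.
  have := test_small (x k) (t k) (x_bounded k) (t_gt0 k) te Fe.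
  have [[[|m] [tE _ fail]] _] := iter k.
    by move: tg; rewrite tE expr0 mul1r ltxx.
  by rewrite tE exprSr mulrAC mulfK ?gt_eqF//; exact: fail.
(* Bounds [gamma / t k] from rank [N0] on, hence the ratio of the two residuals. *)
pose q := gamma / Num.min e gamma.
have m_gt0 : 0 < Num.min e gamma by rewrite lt_min e_gt0.
have q_ge0 : 0 <= q by rewrite divr_ge0 ?ltW.
(* The successor ensures positivity, as [N0] may be 0. *)
exists N0.+1 => //; apply: (@min_range_bigO _ _ (q ^+ 2 * (B / ((1 - mu) / 2)))).
  by move=> k; exact: sqr_ge0.
move=> N; have [NN|NN] := leqP N N0.+2.
  by rewrite big_geq// mulr_ge0 ?sqr_ge0// (le_trans _ (sum_f 0%N))// big_geq.
apply: (@le_trans _ _ (q ^+ 2 * \sum_(N0.+2 <= k < N) f k)).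
  rewrite mulr_sumr; apply: ler_sum_nat => k /andP[kN _].
  rewrite -exprMn ler_pXn2r// ?nnegrE ?(mulr_ge0 q_ge0) ?enorm_ge0//.
  have [_] := enorm_F_mono H Om_closed Om_convex (x k) Om_neq0 (t_gt0 k) (t_le k).
  rewrite /q mulrAC ler_pdivlMr// [X in _ -> X <= _]mulrC; apply: le_trans.
  by rewrite ler_wpM2r ?enorm_ge0// t_ge// ltnW// ltnW.
rewrite ler_wpM2l ?sqr_ge0//; apply: le_trans (sum_f N).
rewrite [leRHS](@big_cat_nat _ _ _ N0.+2)//=; last exact: ltnW.
by rewrite lerDr; apply: sumr_ge0.
Qed.
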